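(* Let $X$ be locally compact regular, let $\mathcal{A}$ be an algebra of real-valued continuous functions on $X$ vanishing at $\infty$, which separates the points and does not vanish identically at any point of $X$, and assume that $\Lambda(h)$ exists for every $h\in\mathcal{A}$. The following conclusions hold. (a) $(\mu_\alpha)$ satisfies a vague large deviation principle with powers $(t_\alpha)$ and rate function $$J(x)=\sup_{h\in\mathcal{A}}\{h(x)-\Lambda(h)\}\quad\text{for all }x\in X.\qquad(1)$$ If moreover $$\sup_{h\in\mathcal{A}}\{-\Lambda(h)\}\ge\sup_{x\in X,\,h\in\mathcal{A}}\{h(x)-\Lambda(h)\},\qquad(2)$$ then the large deviation principle holds with powers $(t_\alpha)$ and the same rate function $J$, and $$\sup_{K\in\mathcal{K}}\ \inf_{x\in X\setminus K}J(x)\ge\sup_{x\in X}J(x).\qquad(3)$$ (b) If $X$ is Hausdorff and $(\mu_\alpha)$ satisfies a large deviation principle with powers $(t_\alpha)$, then the rate function is given by (1), and (3) implies (2). (c) $(\mu_\alpha)$ is exponentially tight with respect to $(t_\alpha)$ if and only if $\sup_{h\in\mathcal{A}}\{-\Lambda(h)\}=+\infty$.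
   Context: $X$ is a topological space, not reduced to one point, in which compact sets are Borel sets. Locally compact means that each point has a compact neighborhood; ''regular'' does not include Hausdorff. $\mathcal{F},\mathcal{G},\mathcal{K}$ denote the sets of closed, open, compact subsets of $X$. $(\mu_\alpha)$ is a net of Borel probability measures on $X$ and $(t_\alpha)$ a net (same index set) in $]0,+\infty[$ converging to $0$. Write $\mu_\alpha^{t_\alpha}(A)=(\mu_\alpha(A))^{t_\alpha}$ for Borel $A$, and $\mu_\alpha^{t_\alpha}(e^{h/t_\alpha})=\big(\int_X e^{h(x)/t_\alpha}\mu_\alpha(dx)\big)^{t_\alpha}$ for Borel measurable $h$. $\Lambda(h)=\log\lim\mu_\alpha^{t_\alpha}(e^{h/t_\alpha})$ when this limit exists (existence of $\Lambda(h)$ is in $[-\infty,+\infty]$). Convention: $\inf\emptyset=+\infty$. For a function $l:X\to[0,+\infty]$ consider: (U) $\limsup\mu_\alpha^{t_\alpha}(F)\le\sup_{x\in F}e^{-l(x)}$ for all $F\in\mathcal{F}$; (UK) the same inequality for all $F\in\mathcal{K}$; (L) $\sup_{x\in G}e^{-l(x)}\le\liminf\mu_\alpha^{t_\alpha}(G)$ for all $G\in\mathcal{G}$. $(\mu_\alpha)$ satisfies a large deviation principle (resp. vague large deviation principle) with powers $(t_\alpha)$ if (U) and (L) (resp. (UK) and (L)) hold for some $l$; the lower regularization of $l$ (the greatest lower semi-continuous function $\le l$) is then called a rate function. $(\mu_\alpha)$ is exponentially tight with respect to $(t_\alpha)$ if for each $\varepsilon>0$ there is a compact $K\subset X$ with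 $\limsup\mu_\alpha^{t_\alpha}(X\setminus K)<\varepsilon$. Algebras are real algebras under pointwise operations, not necessarily unital. A continuous function $h$ vanishes at $\infty$ if $\{x:|h(x)|\ge\varepsilon\}$ is compact for every $\varepsilon>0$ (equivalently, $h$ extended by $h(\infty)=0$ is continuous on the one-point compactification of $X$, in which the neighborhoods of $\infty$ are given by complements of closed compact subsets of $X$). $\mathcal{A}$ separates the points if for all $x\ne y$ there is $h\in\mathcal{A}$ with $h(x)\ne h(y)$; it does not vanish identically at any point if for every $x$ there is $h\in\mathcal{A}$ with $h(x)\neq0$. *)

(* Defs.v *)
From HB Require Import structures.
From mathcomp Require Export all_boot all_order all_algebra.
From mathcomp Require Export all_classical all_reals all_analysis.

Set Implicit Arguments.
Unset Strict Implicit.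
Unset Printing Implicit Defensive.

Export Order.TTheory GRing.Theory Num.Theory.
Export numFieldNormedType.Exports.

#[global] Open Scope classical_set_scope.
#[global] Open Scope ring_scope.

Notation borel X := (g_sigma_algebraType (@open X)).

Section Nets.
Context {dI : Order.disp_t} (I : preorderType dI).

Definition directed : Prop :=
  [set: I] !=set0 /\ forall i j : I, exists k, (i <= k)%O /\ (j <= k)%O.

Definition tails : set_system I :=
  filter_from [set: I] (fun i => [set j | (i <= j)%O]).

(* limf_esup and limf_einf ask for a filteredType but do not use that
   structure; principal_filter_type I is I with the trivial one. *)
Definition net_limsup {R : realType} (u : I -> \bar R) : \bar R :=
  limf_esup (u : principal_filter_type I -> \bar R) tails.

Definition net_liminf {R : realType} (u : I -> \bar R) : \bar R :=
  limf_einf (u : principal_filter_type I -> \bar R) tails.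

End Nets.
Arguments tails {dI} I.

Section Topology.
Context {X : topologicalType} {R : realType}.

(* The library's locally_compact asks for compact neighborhoods that are
   moreover closed, which differs in non-Hausdorff spaces. *)
Definition compact_neighborhoods : Prop :=
  forall x : X, exists2 K, nbhs x K & compact K.

Definition continuous_vanishing_at_infinity (h : X -> R) : Prop :=
  continuous h /\ forall e : R, 0 < e -> compact [set x | e <= `|h x|].

Definition function_algebra (A : set (X -> R)) : Prop :=
  [/\ A (fun=> 0),
      forall f g, A f -> A g -> A (fun x => f x + g x),
      forall (a : R) f, A f -> A (fun x => a * f x) &
      forall f g, A f -> A g -> A (fun x => f x * g x)].

Definition separates_points (A : set (X -> R)) : Prop :=
  forall x y : X, x <> y -> exists2 h, A h & h x <> h y.

Definition vanishes_nowhere (A : set (X -> R)) : Prop :=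
  forall x : X, exists2 h, A h & h x <> 0.

Definition is_lower_regularization (l J : X -> \bar R) : Prop :=
  [/\ lower_semicontinuous J,
      forall x, (J x <= l x)%E &
      forall g : X -> \bar R, lower_semicontinuous g ->
        (forall x, (g x <= l x)%E) -> forall x, (g x <= J x)%E].

End Topology.
Arguments compact_neighborhoods X : clear implicits.

Section LargeDeviations.
Context {R : realType} {X : ptopologicalType}.
Context {dI : Order.disp_t} {I : preorderType dI}.
Variables (mu : I -> probability (borel X) R) (t : I -> R).
Local Open Scope ereal_scope.

Definition measure_power (S : set X) (i : I) : \bar R := mu i S `^ t i.

Definition exp_integral_power (h : X -> R) (i : I) : \bar R :=
  (\int[mu i]_x (expR (h x / t i))%:E) `^ t i.

Definition Lambda_exists (h : X -> R) : Prop :=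
  exists l : \bar R, exp_integral_power h @ tails I --> l.

Definition Lambda (h : X -> R) : \bar R :=
  lne (lim (exp_integral_power h @ tails I)).

(* The supremum is taken in [0, +oo], so that it is 0 when S is empty;
   ereal_sup set0 is -oo. *)
Definition sup_expN (l : X -> \bar R) (S : set X) : \bar R :=
  ereal_sup (0 |` [set expeR (- l x) | x in S]).

Definition upper_bound_on (C : set (set X)) (l : X -> \bar R) : Prop :=
  forall S, C S -> net_limsup (measure_power S) <= sup_expN l S.

Definition lower_bound_open (l : X -> \bar R) : Prop :=
  forall G : set X, open G -> sup_expN l G <= net_liminf (measure_power G).

Definition LDP (l : X -> \bar R) : Prop :=
  [/\ forall x, 0 <= l x, upper_bound_on closed l & lower_bound_open l].

Definition vague_LDP (l : X -> \bar R) : Prop :=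
  [/\ forall x, 0 <= l x, upper_bound_on compact l & lower_bound_open l].

Definition LDP_with_rate (J : X -> \bar R) : Prop :=
  exists2 l, LDP l & is_lower_regularization l J.

Definition vague_LDP_with_rate (J : X -> \bar R) : Prop :=
  exists2 l, vague_LDP l & is_lower_regularization l J.

Definition exponentially_tight : Prop :=
  forall e : R, (0 < e)%R ->
    exists2 K : set X, compact K & net_limsup (measure_power (~` K)) < e%:E.

End LargeDeviations.

(* Main.v *)
Require Import Defs.
From mathcomp Require Import measurable_realfun ring lra.

Set Implicit Arguments.
Unset Strict Implicit.
Unset Printing Implicit Defensive.

(** No Stone-Weierstrass approximation is needed.  Upper bounds come from
    Chebyshev's inequality [mu^t (h >= a) <= e^(-a) mu^t (e^(h/t))] and finite
    covers.  For the lower bound at a point [x] of an open set [G], completing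
    squares produces in the algebra itself a function [h] that is maximal at [x]
    and at most [h x - m] off [G]; then
    [e^(Lambda h - h x) <= max (liminf mu^t G) (e^(-m))], and [m] tends to
    infinity.  Similarly, a function [p >= 0] of the algebra with [p >= 1] on a
    compact set [K] gives [h := - c p], for which [Lambda h] is controlled by
    the mass away from [K]; this yields (3) => (2) and exponential tightness.
    Conversely [|h| < e] off a compact set, so that set's complement has mass
    at most [e^(Lambda h + e)] at the exponential scale. *)

(** * Limits superior and inferior along a net, tested against real thresholds *)

Section NetLimits.
Context {R : realType} {dI : Order.disp_t} {I : preorderType dI}.
Local Open Scope ereal_scope.
Implicit Types (u : I -> \bar R) (y z : \bar R).

(** An extended real is the infimum of the reals strictly above it. The asymptotic bounds below go
    through this, so that they only handle real thresholds [r]. *)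
Lemma le_real_upper_bounds y z : (forall r : R, y < r%:E -> z <= r%:E) -> z <= y.
Proof.
case: y => [y| |] yz; last 2 first.
- exact: leey.
- case: z yz => [z| |] // yz; last by have := yz _ (ltNyr 0%R).
  by have := yz _ (ltNyr (z - 1)%R); rewrite lee_fin lerDl oppr_ge0 ler10.
apply/lee_addgt0Pr => e e0; rewrite -EFinD; apply: yz.
by rewrite lte_fin ltrDl.
Qed.

Lemma le_real_lower_bounds y z : (forall r : R, r%:E < y -> r%:E <= z) -> y <= z.
Proof.
move=> yz; rewrite -leeN2; apply: le_real_upper_bounds => r.
by rewrite leeNl -EFinN lteNl -EFinN; exact: yz.
Qed.

Lemma tails_proper_filter : directed I -> ProperFilter (tails I).
Proof.
move=> [[i0 _] dir]; apply: filter_from_proper.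
  apply: filter_from_filter; first by exists i0.
  move=> i j _ _; have [k [ik jk]] := dir i j; exists k => // l kl.
  by split; apply: le_trans kl.
by move=> i _; exists i => /=; exact: lexx.
Qed.

Lemma net_limsup_le u y :
  (forall r : R, y < r%:E -> \forall i \near tails I, u i <= r%:E) ->
  net_limsup u <= y.
Proof.
move=> uy; apply: le_real_upper_bounds => r /uy ur.
apply: ge_ereal_inf; exists (ereal_sup (u @` [set i | u i <= r%:E])).
  by exists [set i | u i <= r%:E].
by apply: ge_ereal_sup => _ [i ui <-].
Qed.

Lemma net_limsup_lt u y : net_limsup u < y -> \forall i \near tails I, u i < y.
Proof.
move=> /ereal_inf_lt[_ [V FV <-] Vy].
case: FV => i _ iV; exists i => // j /iV Vj.
by apply: le_lt_trans Vy; apply: ereal_sup_ubound; exists j.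
Qed.

Lemma net_liminf_ge u y :
  (forall r : R, r%:E < y -> \forall i \near tails I, r%:E <= u i) ->
  y <= net_liminf u.
Proof.
move=> uy; rewrite /net_liminf /limf_einf leeNr.
apply: net_limsup_le => r yr.
have /uy : (- r)%:E < y by rewrite EFinN lteNl.
by case=> i _ ir; exists i => // j /ir /=; rewrite EFinN leeNl.
Qed.

Lemma net_liminf_gt u y : y < net_liminf u -> \forall i \near tails I, y < u i.
Proof.
rewrite /net_liminf /limf_einf lteNr => /net_limsup_lt[i _ iu].
by exists i => // j /iu /=; rewrite lteN2.
Qed.

Lemma net_liminf_le_limsup u : directed I -> net_liminf u <= net_limsup u.
Proof.
move=> /tails_proper_filter PF; apply: le_real_upper_bounds => r /net_limsup_lt ur.
rewrite leNgt; apply/negP => /net_liminf_gt ru.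
have [i []] := @filter_ex _ _ PF _ (filterI ur ru).
by move=> /lt_trans/[apply]; rewrite ltxx.
Qed.

End NetLimits.

(** * Borel measurability of open sets, closed sets and continuous functions *)

Section BorelSets.
Context {R : realType} {X : ptopologicalType}.

Lemma open_borel (G : set X) : open G -> measurable (G : set (borel X)).
Proof. by move=> oG; apply: sub_sigma_algebra. Qed.

Lemma closed_borel (F : set X) : closed F -> measurable (F : set (borel X)).
Proof.
move=> cF; rewrite -(setCK F); apply: measurableC; apply: open_borel.
exact: closed_openC.
Qed.

Lemma continuous_borel_measurable (h : X -> R) :
  continuous h -> measurable_fun [set: borel X] (h : borel X -> R).
Proof.
move=> /continuousP ch; apply: (measurability _ (RGenOpens.measurableE R)).
move=> _ [_ [a [b ->] <-]]; rewrite setTI; apply: open_borel.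
exact/ch/interval_open.
Qed.

End BorelSets.

(** * Non-asymptotic estimates for a single probability and a single power *)

Section LaplaceEstimates.
Context {R : realType} {X : ptopologicalType}.
Variable P : probability (borel X) R.
Local Open Scope ereal_scope.

Lemma expR_div_poweR (a s : R) : (0 < s)%R ->
  (expR (a / s))%:E `^ s = (expR a)%:E.
Proof. by move=> s0; rewrite poweR_EFin -expRM divfK ?gt_eqF. Qed.

Lemma measurable_expR_div (h : X -> R) (s : R) : continuous h ->
  measurable_fun [set: borel X] (fun x : borel X => (expR (h x / s))%:E : \bar R).
Proof.
move=> /continuous_borel_measurable mh; apply/measurable_EFinP.
apply: measurableT_comp => //.
exact: measurable_funM.
Qed.

(** Chebyshev's inequality: integrate [e^(a/s) 1_S <= e^(h/s)] and raise to the power [s]. *)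
Lemma exp_integral_power_ge (h : X -> R) (S : set (borel X)) (s a : R) :
  (0 < s)%R -> continuous h -> measurable S ->
  (forall x, S x -> a <= h x)%R ->
  (expR a)%:E * P S `^ s <= (\int[P]_x (expR (h x / s))%:E) `^ s.
Proof.
move=> s0 ch mS aS.
rewrite -(expR_div_poweR a s0) -poweRM ?lee_fin ?expR_ge0//.
apply: gt0_ler_poweR; rewrite ?(ltW s0) ?in_itv/= ?leey ?andbT//.
- by rewrite mule_ge0 ?lee_fin ?expR_ge0.
- by apply: integral_ge0 => x _; rewrite lee_fin expR_ge0.
rewrite -[S in P S]setIT -integral_indic// -ge0_integralZl_EFin ?expR_ge0//; last first.
  exact/measurable_EFinP/measurable_indic.
apply: ge0_le_integral => //.
- apply/measurable_EFinP/measurable_funM => //; exact: measurable_indic.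
- exact: measurable_expR_div.
move=> x _; rewrite -EFinM lee_fin indicE.
case: (boolP (x \in S)) => [/set_mem/aS ax|_].
  by rewrite mulr1 ler_expR ler_pM2r ?invr_gt0.
by rewrite mulr0 expR_ge0.
Qed.

(** Pointwise [e^(h/s) <= e^(a/s) (1_S + e^(-m/s))]. After integration the sum is at most twice the
    maximum of its terms; the resulting factor [2 ^ s] tends to 1 with [s -> 0]. *)
Lemma exp_integral_power_le (h : X -> R) (S : set (borel X)) (s a m : R) :
  (0 < s)%R -> continuous h -> measurable S ->
  (forall x, S x -> h x <= a)%R -> (forall x, ~ S x -> h x <= a - m)%R ->
  (\int[P]_x (expR (h x / s))%:E) `^ s <=
    (2 `^ s * expR a)%:E * maxe (P S `^ s) (expR (- m))%:E.
Proof.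
move=> s0 ch mS aS mSC.
have le_int : \int[P]_x (expR (h x / s))%:E <=
    (expR (a / s))%:E * (P S + (expR (- m / s))%:E).
  have -> : P S + (expR (- m / s))%:E =
      \int[P]_x ((\1_S x)%:E + (expR (- m / s))%:E).
    rewrite ge0_integralD//.
    - rewrite integral_indic// setIT (integral_cst P measurableT).
      rewrite -[in LHS](mule1 (expR _)%:E); congr (_ + _ * _).
      exact/esym/probability_setT.
    - exact/measurable_EFinP/measurable_indic.
  rewrite -ge0_integralZl_EFin ?expR_ge0//; last 2 first.
  - by move=> x _; rewrite -EFinD lee_fin addr_ge0 ?expR_ge0.
  - apply/measurable_EFinP/measurable_funD => //; exact: measurable_indic.
  apply: ge0_le_integral => //.
  - exact: measurable_expR_div.
  - apply/measurable_EFinP/measurable_funM => //.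
    apply: measurable_funD => //; exact: measurable_indic.
  move=> x _; rewrite -EFinD -EFinM lee_fin indicE.
  case: (boolP (x \in S)) => [/set_mem/aS xa|/negP xS].
    rewrite mulrDr mulr1 -[leLHS]addr0 lerD ?mulr_ge0 ?expR_ge0//.
    by rewrite ler_expR ler_pM2r ?invr_gt0.
  rewrite add0r -expRD ler_expR -mulrDl ler_pM2r ?invr_gt0//.
  by apply: mSC => Sx; apply: xS; exact: mem_set.
pose M := maxe (P S) (expR (- m / s))%:E.
have M0 : 0 <= M by rewrite le_max measure_ge0.
have int_M : \int[P]_x (expR (h x / s))%:E <= (2 * expR (a / s))%:E * M.
  apply: (le_trans le_int).
  rewrite [(2 * _)%R]mulrC EFinM -muleA lee_wpmul2l ?lee_fin ?expR_ge0//.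
  by rewrite mule_natl mule2n leeD// le_max lexx ?orbT.
apply: (@le_trans _ _ (((2 * expR (a / s))%:E * M) `^ s)).
  apply: gt0_ler_poweR; rewrite ?(ltW s0) ?in_itv/= ?leey ?andbT//.
  - by apply: integral_ge0 => x _; rewrite lee_fin expR_ge0.
  - by rewrite mule_ge0// lee_fin mulr_ge0 ?expR_ge0.
rewrite poweRM ?lee_fin ?mulr_ge0 ?expR_ge0//.
rewrite EFinM poweRM ?lee_fin ?expR_ge0// expR_div_poweR// poweR_EFin -EFinM.
rewrite lee_wpmul2l ?lee_fin ?mulr_ge0 ?powR_ge0 ?expR_ge0//.
rewrite -(expR_div_poweR (- m) s0).
by rewrite /M /maxe; case: ifP => _; rewrite le_max lexx ?orbT.
Qed.

Lemma measureU_power_le (S T : set (borel X)) (s : R) :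
  (0 < s)%R -> measurable S -> measurable T ->
  P (S `|` T) `^ s <= (2 `^ s)%:E * maxe (P S `^ s) (P T `^ s).
Proof.
move=> s0 mS mT; set M := maxe (P S) (P T).
have M0 : 0 <= M by rewrite le_max measure_ge0.
apply: (@le_trans _ _ ((2%:E * M) `^ s)).
  apply: gt0_ler_poweR; rewrite ?(ltW s0) ?in_itv/= ?leey ?andbT ?measure_ge0//.
    by rewrite mule_ge0.
  apply: (le_trans (measureU2 _ mS mT)).
  by rewrite mule_natl mule2n leeD// le_max lexx ?orbT.
rewrite poweRM// poweR_EFin lee_wpmul2l ?lee_fin ?powR_ge0//.
by rewrite /M /maxe; case: ifP => _; rewrite le_max lexx ?orbT.
Qed.

End LaplaceEstimates.

(** * Passage to the limit along the net *)

Section Asymptotics.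
Context {R : realType} {X : ptopologicalType}.
Context {dI : Order.disp_t} {I : preorderType dI}.
Variables (mu : I -> probability (borel X) R) (t : I -> R).
Hypotheses (dirI : directed I) (t_gt0 : forall i, (0 < t i)%R).
Hypothesis t_cvg0 : t @ tails I --> (0 : R)%R.
Local Open Scope ereal_scope.

Let tailsF : ProperFilter (tails I) := tails_proper_filter dirI.
Local Existing Instance tailsF.

Lemma near_pow2_le (r : R) : (1 < r)%R -> \forall i \near tails I, (2 `^ t i <= r)%R.
Proof.
move=> r1; have r0 : (0 < r)%R := lt_trans ltr01 r1.
have ln2 : (0 < ln 2 :> R)%R by apply: ln_gt0; rewrite ltr1n.
have lt_ln : (0 < ln r / ln 2 :> R)%R by rewrite divr_gt0// ln_gt0.
have : \forall i \near tails I, (t i < ln r / ln 2)%R.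
  exact: (t_cvg0 (lt_nbhsl lt_ln)).
apply: filterS => i ti.
rewrite /powR pnatr_eq0/= -[leRHS]lnK ?posrE// ler_expR.
by rewrite -ler_pdivlMr// ltW.
Qed.

(** The factors [2 ^ t i] left by the estimates with two terms disappear in the limit, since [t]
    tends to 0. *)
Lemma net_limsup_le_pow2 (u : I -> \bar R) (y : \bar R) : 0 <= y ->
  (forall r : R, y < r%:E ->
     \forall i \near tails I, u i <= (2 `^ t i)%:E * r%:E) ->
  net_limsup u <= y.
Proof.
case: y => [y| |//] y0 uy; last exact: leey.
apply: net_limsup_le => r; rewrite lee_fin in y0; rewrite lte_fin => yr.
(* The bound is used at the midpoint [r']; since [r / r' > 1], eventually [2 ^ t i * r' <= r]. *)
pose r' := ((y + r) / 2)%R.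
have [yr' r'r r'0] : [/\ (y < r')%R, (r' < r)%R & (0 < r')%R].
  by rewrite /r'; split; lra.
have r1 : (1 < r / r')%R by rewrite ltr_pdivlMr// mul1r.
have /uy ur' : y%:E < r'%:E by rewrite lte_fin.
apply: filterS2 (near_pow2_le r1) ur' => i ti /le_trans; apply.
by rewrite -EFinM lee_fin -ler_pdivlMr.
Qed.

(** Principle of the largest term: at the exponential scale a union weighs no more than its heaviest
    member. *)
Lemma net_limsup_measure_powerU (S T : set X) (y : \bar R) :
  measurable (S : set (borel X)) -> measurable (T : set (borel X)) ->
  net_limsup (measure_power mu t S) <= y ->
  net_limsup (measure_power mu t T) <= y ->
  net_limsup (measure_power mu t (S `|` T)) <= y.
Proof.
move=> mS mT Sy Ty.
have y0 : 0 <= y.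
  apply: le_trans Sy; apply: limf_esup_ge0; first exact: filter_not_empty.
  by move=> i; exact: poweR_ge0.
apply: net_limsup_le_pow2 => // r yr.
have /net_limsup_lt Sr := le_lt_trans Sy yr.
have /net_limsup_lt Tr := le_lt_trans Ty yr.
apply: filterS2 Sr Tr => i Si Ti.
apply: (le_trans (measureU_power_le (mu i) (t_gt0 i) mS mT)).
rewrite lee_wpmul2l ?lee_fin ?powR_ge0//.
by rewrite ge_max !ltW.
Qed.

Lemma net_limsup_measure_power_subset (S T : set X) :
  measurable (S : set (borel X)) -> measurable (T : set (borel X)) ->
  S `<=` T ->
  net_limsup (measure_power mu t S) <= net_limsup (measure_power mu t T).
Proof.
move=> mS mT ST; apply: net_limsup_le => r /net_limsup_lt.
apply: filterS => i /ltW; apply: le_trans.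
apply: gt0_ler_poweR; rewrite ?(ltW (t_gt0 i)) ?in_itv/= ?leey ?andbT//.
by apply: le_measure; rewrite ?inE.
Qed.

Lemma net_liminf_measure_power_subset (S T : set X) :
  measurable (S : set (borel X)) -> measurable (T : set (borel X)) ->
  S `<=` T ->
  net_liminf (measure_power mu t S) <= net_liminf (measure_power mu t T).
Proof.
move=> mS mT ST; apply: net_liminf_ge => r /net_liminf_gt.
apply: filterS => i /ltW /le_trans; apply.
apply: gt0_ler_poweR; rewrite ?(ltW (t_gt0 i)) ?in_itv/= ?leey ?andbT//.
by apply: le_measure; rewrite ?inE.
Qed.

Section Laplace.
Variables (h : X -> R) (l : R).
Hypothesis h_cont : continuous h.
Hypothesis h_cvg : exp_integral_power mu t h @ tails I --> (expR l)%:E.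

(** The limit form of Chebyshev's inequality; [l] stands for the value of [Lambda] at [h]. *)
Lemma net_limsup_measure_power_le (S : set X) (a : R) :
  measurable (S : set (borel X)) -> (forall x, S x -> a <= h x)%R ->
  net_limsup (measure_power mu t S) <= (expR (l - a))%:E.
Proof.
move=> mS aS; apply: net_limsup_le => r.
rewrite lte_fin expRB ltr_pdivrMr ?expR_gt0// => lr.
have : \forall i \near tails I,
    exp_integral_power mu t h i < (r * expR a)%:E.
  by have := h_cvg (open_ereal_lt' _); apply; rewrite lte_fin.
apply: filterS => i /ltW /(le_trans _) {}lr.
rewrite -(@lee_pmul2l _ (expR a)%:E)// ?lte_fin ?expR_gt0//.
rewrite -EFinM [(expR a * r)%R]mulrC; apply: lr.
exact: exp_integral_power_ge.
Qed.

(** The main tool for lower bounds on the mass of [S]. Were a real [r] above the right-hand side and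
    below the left-hand one, the upper estimate of the integral would eventually force the mass of
    [S] to the power [t i] to be at least [r]. *)
Lemma expR_le_net_liminf (S : set X) (a m : R) :
  measurable (S : set (borel X)) ->
  (forall x, S x -> h x <= a)%R -> (forall x, ~ S x -> h x <= a - m)%R ->
  (expR (l - a))%:E <= maxe (net_liminf (measure_power mu t S)) (expR (- m))%:E.
Proof.
move=> mS aS mSC; apply: le_real_upper_bounds => r.
rewrite gt_max => /andP[Lr mr]; rewrite leNgt; apply/negP => rl.
have r0 : (0 < r)%R by apply: lt_trans (expR_gt0 (- m)) _; rewrite -lte_fin.
have ra0 : (0 < r * expR a)%R by rewrite mulr_gt0 ?expR_gt0.
rewrite lte_fin expRB ltr_pdivlMr ?expR_gt0// in rl.
(* The gap between [r * expR a] and [q] absorbs the factor [2 ^ t i]; the integrals eventually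
   exceed [q] because their limit does. *)
pose q := ((r * expR a + expR l) / 2)%R.
have [raq ql] : (r * expR a < q)%R /\ (q < expR l)%R by rewrite /q; split; lra.
have q1 : (1 < q / (r * expR a))%R by rewrite ltr_pdivlMr// mul1r.
have : \forall i \near tails I, q%:E < exp_integral_power mu t h i.
  by have := h_cvg (open_ereal_gt' _); apply; rewrite lte_fin.
move=> /(filterI (near_pow2_le q1)) qh.
suff : r%:E <= net_liminf (measure_power mu t S) by rewrite leNgt Lr.
apply: net_liminf_ge => r' r'r; apply: filterS qh => i [+ qi].
rewrite ler_pdivlMr// => tq; apply/ltW/(lt_le_trans r'r).
have := exp_integral_power_le (mu i) (t_gt0 i) h_cont mS aS mSC.
move=> /(lt_le_trans qi) {}qi; rewrite leNgt; apply/negP => Sr.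
suff : q%:E < (2 `^ t i * expR a)%:E * r%:E.
  by rewrite -EFinM lte_fin -mulrA [(expR a * r)%R]mulrC ltNge tq.
apply: (lt_le_trans qi); apply: lee_wpmul2l.
  by rewrite lee_fin mulr_ge0 ?powR_ge0 ?expR_ge0.
by rewrite ltW// gt_max Sr.
Qed.

End Laplace.

(** For bounded [h] the limit lies between two positive reals, so its logarithm is finite. *)
Lemma Lambda_fin (h : X -> R) (M : R) :
  continuous h -> (forall x, `|h x| <= M)%R -> Lambda_exists mu t h ->
  exp_integral_power mu t h @ tails I --> (expR (fine (Lambda mu t h)))%:E /\
  Lambda mu t h = (fine (Lambda mu t h))%:E.
Proof.
move=> ch hM [y hy].
have limE : lim (exp_integral_power mu t h @ tails I) = y.
  exact: cvg_lim.
have My : (expR (- M))%:E <= y.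
  rewrite leNgt; apply/negP => yM.
  have : \forall i \near tails I, exp_integral_power mu t h i < (expR (- M))%:E.
    exact: (hy _ (open_ereal_lt' _)).
  move=> /filter_ex[i]; rewrite ltNge => /negP; apply.
  have := @exp_integral_power_ge _ _ (mu i) h setT _ (- M)%R (t_gt0 i) ch measurableT.
  rewrite (@probability_setT _ _ _ (mu i)) poweR1r mule1; apply => x _.
  by have := hM x; rewrite ler_norml => /andP[].
(* A crude bound is enough for finiteness: the upper estimate on the whole space with [m = 0] gives
   [2 ^ t i * expR M], and eventually [2 ^ t i <= 2]. *)
have yM : y <= (2 * expR M)%:E.
  rewrite leNgt; apply/negP => yM.
  have : \forall i \near tails I, (2 * expR M)%:E < exp_integral_power mu t h i.
    exact: (hy _ (open_ereal_gt' _)).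
  have /near_pow2_le two : (1 < 2 :> R)%R by rewrite ltr1n.
  move=> /(filterI two)/filter_ex[i [ti]]; rewrite ltNge => /negP; apply.
  have le_hM x : (h x <= M)%R by have := hM x; rewrite ler_norml => /andP[].
  have := @exp_integral_power_le _ _ (mu i) h setT _ M 0 (t_gt0 i) ch measurableT.
  rewrite (@probability_setT _ _ _ (mu i)) poweR1r oppr0 expR0 maxxx mule1.
  move=> /(_ (fun x _ => le_hM x) (fun x nT => False_ind _ (nT Logic.I)))/le_trans; apply.
  by rewrite lee_fin ler_wpM2r ?expR_ge0.
rewrite /Lambda limE; case: y hy {limE} My yM => [y hy|//|//].
rewrite !lee_fin => My _.
have y0 : (0 < y)%R := lt_le_trans (expR_gt0 _) My.
by rewrite lne_EFin//= lnK ?posrE.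
Qed.

End Asymptotics.

(** * Compactness and continuous real functions *)

(** This plays the role of finite subcovers. If [Q K] failed, the sets [B] with [Q (K \ B)] would
    form a proper filter containing [K]; a cluster point in [K] has a neighborhood [V] with [Q V],
    yet the complement of [V] is in the filter. *)
Lemma compact_induction (X : topologicalType) (Q : set (set X)) (K : set X) :
  compact K -> Q set0 ->
  (forall S T, Q S -> Q T -> Q (S `|` T)) ->
  (forall S T, S `<=` T -> Q T -> Q S) ->
  (forall x, K x -> exists2 V, nbhs x V & Q V) -> Q K.
Proof.
move=> cK Q0 QU Qsub locQ; apply: contrapT => nQK.
pose F : set_system X := [set B | Q (K `\` B)].
have FF : ProperFilter F.
  apply: Build_ProperFilter; first by rewrite /F/= setD0.
  split.
  - by rewrite /F/= setDT.
  - by move=> A B; rewrite /F/= setDIr; exact: QU.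
  - by move=> A B AB; apply: Qsub; exact: setDS.
have [|x [Kx clx]] := cK F FF; first by rewrite /F/= setDv.
have [V Vx QV] := locQ x Kx.
have /clx/(_ Vx)[y []] // : F (~` V).
by apply: Qsub QV => y [_ /contrapT].
Qed.

Section RealFunctions.
Context {R : realType} {X : topologicalType}.

Lemma continuous_lt_nbhs (h : X -> R) (x : X) (a : R) :
  continuous h -> h x < a -> nbhs x [set y | h y < a].
Proof. by move=> ch /lt_nbhsl; exact: ch. Qed.

Lemma continuous_gt_nbhs (h : X -> R) (x : X) (a : R) :
  continuous h -> a < h x -> nbhs x [set y | a < h y].
Proof. by move=> ch /lt_nbhsr; exact: ch. Qed.

Lemma continuous_gt_open (h : X -> R) (a : R) :
  continuous h -> open [set y | a < h y].
Proof.
by move=> ch; rewrite openE => x ax; exact: continuous_gt_nbhs.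
Qed.

Lemma continuous_ge_closed (h : X -> R) (a : R) :
  continuous h -> closed [set y | a <= h y].
Proof.
move=> ch; rewrite -openC openE => x /= /negP; rewrite -ltNge => hx.
by apply: filterS (continuous_lt_nbhs ch hx) => y /= hy; rewrite leNgt hy.
Qed.

Lemma normr_continuous_comp (h : X -> R) :
  continuous h -> continuous (fun x => `|h x|).
Proof. by move=> ch x; apply: cvg_norm; exact: ch. Qed.

(** Off the compact set where [1 <= |h|] the bound is 1; on it, local boundedness spreads by
    compactness. *)
Lemma vanishing_bounded (h : X -> R) :
  continuous_vanishing_at_infinity h -> exists M, forall x, `|h x| <= M.
Proof.
move=> [ch /(_ 1 ltr01) c1].
have [M hM] : exists M, forall x, 1 <= `|h x| -> `|h x| <= M.
  apply: (@compact_induction _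
    (fun S => exists M, forall x, S x -> `|h x| <= M) _ c1).
  - by exists 0.
  - move=> S T [M1 S1] [M2 T2]; exists (Num.max M1 M2) => x.
    by rewrite le_max => -[/S1->|/T2->]; rewrite ?orbT.
  - by move=> S T ST [M TM]; exists M => x /ST/TM.
  - move=> x _; exists [set y | `|h y| < `|h x| + 1].
      by apply: continuous_lt_nbhs (normr_continuous_comp ch) _; rewrite ltrDl.
    by exists (`|h x| + 1) => y /ltW.
exists (Num.max 1 M) => x; rewrite le_max.
by have [/ltW->//|/hM->] := ltP `|h x| 1; rewrite orbT.
Qed.

End RealFunctions.

(** * Auxiliary functions built inside the algebra by sums of squares *)

Section Algebra.
Context {R : realType} {X : topologicalType}.
Variable A : set (X -> R).
Hypothesis algA : function_algebra A.
Hypothesis A_vanishing : forall h, A h -> continuous_vanishing_at_infinity h.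

Let A0 : A (fun=> 0). Proof. by case: algA. Qed.
Let AD f g : A f -> A g -> A (fun x => f x + g x).
Proof. by case: algA => _ + _ _; apply. Qed.
Let AZ (a : R) f : A f -> A (fun x => a * f x).
Proof. by case: algA => _ _ + _; apply. Qed.
Let AM f g : A f -> A g -> A (fun x => f x * g x).
Proof. by case: algA => _ _ _; apply. Qed.
Let A_continuous h : A h -> continuous h.
Proof. by move=> /A_vanishing[]. Qed.

(** A substitute on [K] for the constant 1, which the algebra may lack: a finite sum of suitably
    scaled squares. *)
Lemma algebra_ge1_on_compact (K : set X) : vanishes_nowhere A -> compact K ->
  exists2 p, A p & (forall x, 0 <= p x) /\ (forall x, K x -> 1 <= p x).
Proof.
move=> A_nowhere cK; apply: (@compact_induction _ (fun S => exists2 p, A p &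
  (forall x, 0 <= p x) /\ (forall x, S x -> 1 <= p x)) _ cK).
- by exists (fun=> 0).
- move=> S T [p Ap [p0 p1]] [q Aq [q0 q1]].
  exists (fun x => p x + q x); first exact: AD.
  split=> x; first by rewrite addr_ge0.
  by have := p0 x; have := q0 x; move=> ? ? [/p1|/q1] ?; lra.
- move=> S T ST [p Ap [p0 p1]]; exists p => //; split=> // x /ST; exact: p1.
move=> x _; have [g Ag /eqP gx] := A_nowhere x.
(* The scaling gives [p x = 2], so that [p > 1] on a whole neighborhood of [x]. *)
pose p := fun z => 2 / (g x * g x) * (g z * g z).
have Ap : A p by apply: AZ; exact: AM.
have gg0 : g x * g x != 0 by rewrite mulf_neq0.
exists [set z | 1 < p z].
  by apply: (continuous_gt_nbhs (A_continuous Ap)); rewrite /p divfK// ltr1n.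
exists p => //; split=> [z|z /ltW//].
by rewrite mulr_ge0 ?divr_ge0 -?expr2 ?sqr_ge0.
Qed.

(* Completing the square: [2 g(x) g - g^2 = g(x)^2 - (g - g(x))^2] lies in the
   algebra although the constant [g(x)^2] need not. *)
Lemma algebra_quadratic_peak (g : X -> R) (x : X) (c : R) : A g ->
  exists2 h, A h & forall z, h z = h x - c * (g z - g x) ^+ 2.
Proof.
move=> Ag; exists (fun z => c * ((2 * g x) * g z + (- 1) * (g z * g z))).
  by apply: AZ; apply: AD; apply: AZ => //; exact: AM.
by move=> z; ring.
Qed.

(** Some [g0] in the algebra is nonzero at [x]. Where [|g0|] is below half of [|g0 x|], a quadratic
    peak of [g0] has already dropped by [m]; the rest of the complement of [G] is compact, and
    finitely many peaks given by separation of points deal with it. All peaks are maximal at [x], so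
    their sum keeps every drop. *)
Lemma algebra_peak (x : X) (G : set X) (m : R) :
  separates_points A -> vanishes_nowhere A -> open G -> G x ->
  exists2 h, A h &
    (forall y, h y <= h x) /\ (forall y, ~ G y -> h y <= h x - m).
Proof.
move=> A_sep A_nowhere oG Gx.
(* A larger [m] only strengthens the conclusion, and positive [m] makes the weights of the squares
   positive. *)
wlog m0 : m / 0 < m.
  move=> /(_ (Num.max 1 m)); rewrite lt_max ltr01 => /(_ isT)[h Ah [hx hG]].
  exists h => //; split=> // y /hG/le_trans; apply.
  by rewrite lerB// le_max lexx orbT.
have [g0 Ag0 /eqP g0x] := A_nowhere x.
pose e := `|g0 x| / 2.
have e0 : 0 < e by rewrite divr_gt0 ?normr_gt0.
have [cg0 /(_ e e0) cC] := A_vanishing Ag0.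
have cCG : compact ([set y | e <= `|g0 y|] `&` ~` G).
  by apply: compact_closedI => //; exact: open_closedC.
have [h1 Ah1 [h1x h1K]] : exists2 h, A h & (forall y, h y <= h x) /\
    forall y, ([set y | e <= `|g0 y|] `&` ~` G) y -> h y <= h x - m.
  apply: (@compact_induction _ (fun S => exists2 h, A h &
    (forall y, h y <= h x) /\ forall y, S y -> h y <= h x - m) _ cCG).
  - by exists (fun=> 0).
  - move=> S T [h Ah [hx hS]] [k Ak [kx kT]].
    exists (fun x => h x + k x); first exact: AD.
    split=> y; first by rewrite lerD.
    by move=> [/hS ?|/kT ?]; have := hx y; have := kx y; lra.
  - by move=> S T ST [h Ah [hx hT]]; exists h => //; split=> // y /ST; exact: hT.
  move=> y [_ nGy].
  have [g Ag /eqP gxy] : exists2 h, A h & h y <> h x.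
    by apply: A_sep => yx; apply: nGy; rewrite yx.
  have g2 : 0 < (g y - g x) ^+ 2 by rewrite exprn_even_gt0//= subr_eq0.
  (* With this weight the drop at [y] is exactly [2 * m], hence still more than [m] near [y]. *)
  have [h Ah hE] := algebra_quadratic_peak x (2 * m / (g y - g x) ^+ 2) Ag.
  exists [set z | h z < h x - m].
    apply: (continuous_lt_nbhs (A_continuous Ah)).
    by rewrite hE divfK ?gt_eqF//; lra.
  exists h => //; split=> [z|z /ltW//].
  by rewrite hE lerBlDr lerDl mulr_ge0 ?sqr_ge0// divr_ge0 ?ltW// mulr_gt0.
(* Where [|g0 y| < e], the choice of [e] as half of [|g0 x|] gives [|g0 y - g0 x| >= e], so the drop
   is at least [m]. *)
have [h0 Ah0 h0E] := algebra_quadratic_peak x (m / e ^+ 2) Ag0.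
have h0x y : h0 y <= h0 x.
  by rewrite h0E lerBlDr lerDl mulr_ge0 ?sqr_ge0// divr_ge0 ?exprn_ge0// ltW.
exists (fun y => h0 y + h1 y); first exact: AD.
split=> y; first by rewrite lerD.
move=> nGy; have [eg|ge] := leP e `|g0 y|.
  by have := h1K y (conj eg nGy); have := h0x y; lra.
suff : h0 y <= h0 x - m by have := h1x y; lra.
rewrite h0E lerB// -[leLHS](@divfK _ (e ^+ 2)) ?expf_neq0 ?gt_eqF//.
have c0 : 0 <= m / e ^+ 2 by rewrite divr_ge0 ?exprn_ge0 ?(ltW e0) ?(ltW m0).
apply: (ler_wpM2l c0); rewrite -[leRHS]real_normK ?num_real//.
rewrite ler_pXn2r ?nnegrE ?normr_ge0 ?(ltW e0)//.
have := lerB_dist (g0 x) (g0 y); rewrite distrC => /(le_trans _); apply.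
by move: ge; rewrite /e; lra.
Qed.

End Algebra.

(** * Suprema of [e^(-l)] over sets *)

Lemma expeRN_le {R : realType} (z : \bar R) (r : R) :
  (expeR (- z) <= (expR (- r))%:E)%E = (r%:E <= z)%E.
Proof. by rewrite -[(expR _)%:E]/(expeR (- r%:E)) lee_expeR leeN2. Qed.

Lemma expeRN_lt {R : realType} (z : \bar R) (r : R) :
  (expeR (- z) < (expR (- r))%:E)%E = (r%:E < z)%E.
Proof. by rewrite -[(expR _)%:E]/(expeR (- r%:E)) lte_expeR lteN2. Qed.

Section SupExpN.
Context {R : realType} {X : ptopologicalType}.
Local Open Scope ereal_scope.
Implicit Types (l : X -> \bar R) (S : set X) (y : \bar R).

Lemma sup_expN_ge0 l S : 0 <= sup_expN l S.
Proof. by apply: ereal_sup_ubound; left. Qed.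

Lemma sup_expN_ge l S x : S x -> expeR (- l x) <= sup_expN l S.
Proof. by move=> Sx; apply: ereal_sup_ubound; right; exists x. Qed.

Lemma sup_expN_le l S y : 0 <= y -> (forall x, S x -> expeR (- l x) <= y) ->
  sup_expN l S <= y.
Proof. by move=> y0 Sy; apply: ge_ereal_sup => _ [->|[x /Sy ? <-]]. Qed.

Lemma sup_expN_subset l S T : S `<=` T -> sup_expN l S <= sup_expN l T.
Proof.
move=> ST; apply: sup_expN_le => [|x /ST]; first exact: sup_expN_ge0.
exact: sup_expN_ge.
Qed.

End SupExpN.

(** * Bounds with rate [J], and exponential tightness *)

Section VagueLargeDeviations.
Context {R : realType} {X : ptopologicalType}.
Context {dI : Order.disp_t} {I : preorderType dI}.
Variables (mu : I -> probability (borel X) R) (t : I -> R) (A : set (X -> R)).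
Hypothesis compact_borel :
  forall K : set X, compact K -> measurable (K : set (borel X)).
Hypotheses (dirI : directed I) (t_gt0 : forall i, 0 < t i).
Hypothesis t_cvg0 : t @ tails I --> (0 : R).
Hypothesis algA : function_algebra A.
Hypothesis A_vanishing : forall h, A h -> continuous_vanishing_at_infinity h.
Hypotheses (A_sep : separates_points A) (A_nowhere : vanishes_nowhere A).
Hypothesis A_Lambda : forall h, A h -> Lambda_exists mu t h.
Local Open Scope ereal_scope.

Let J : X -> \bar R :=
  fun x => ereal_sup [set (h x)%:E - Lambda mu t h | h in A].
(** The real value of [Lambda], which is finite on [A] because functions vanishing at infinity are
    bounded. *)
Let lam (h : X -> R) : R := fine (Lambda mu t h).

Let A0 : A (fun=> 0%R). Proof. by case: algA. Qed.
Let A_continuous h : A h -> continuous h.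
Proof. by move=> /A_vanishing[]. Qed.

Let tailsF : ProperFilter (tails I) := tails_proper_filter dirI.
Local Existing Instance tailsF.

Let exp_lam_cvg h : A h ->
  exp_integral_power mu t h @ tails I --> (expR (lam h))%:E.
Proof.
move=> Ah; have [M hM] := vanishing_bounded (A_vanishing Ah).
by have [] := Lambda_fin dirI t_gt0 t_cvg0 (A_continuous Ah) hM (A_Lambda Ah).
Qed.

Let LambdaE h : A h -> Lambda mu t h = (lam h)%:E.
Proof.
move=> Ah; have [M hM] := vanishing_bounded (A_vanishing Ah).
by have [] := Lambda_fin dirI t_gt0 t_cvg0 (A_continuous Ah) hM (A_Lambda Ah).
Qed.

Let lam0 : lam (fun=> 0%R) = 0%R.
Proof.
rewrite /lam /Lambda.
have -> : exp_integral_power mu t (fun=> 0%R) = (fun=> 1).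
  apply/funext => i; rewrite /exp_integral_power.
  under eq_integral do rewrite mul0r expR0.
  rewrite (integral_cst (mu i) measurableT) mul1e.
  by rewrite -[RHS](poweR1r (t i)); congr (_ `^ _); exact: probability_setT.
by rewrite lim_cst// lne1.
Qed.

Let le_J h x : A h -> (h x - lam h)%:E <= J x.
Proof.
by move=> Ah; apply: ereal_sup_ubound; exists h; rewrite // LambdaE.
Qed.

Let lt_J x (a : R) : a%:E < J x -> exists2 h, A h & (a < h x - lam h)%R.
Proof.
move=> /ereal_sup_gt[_ [h Ah <-]]; rewrite LambdaE// => ah.
by exists h; rewrite // -lte_fin.
Qed.

Let J_ge0 x : 0 <= J x.
Proof. by have := le_J x A0; rewrite lam0 subr0. Qed.

(** [J] is a supremum of continuous functions. *)
Lemma J_lower_semicontinuous : lower_semicontinuous J.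
Proof.
move=> x a /lt_J[h Ah ah]; exists [set y | a + lam h < h y]%R.
  by apply: continuous_gt_nbhs; [exact: A_continuous|rewrite -ltrBrDr].
by move=> y /= ahy; apply: lt_le_trans (le_J y Ah); rewrite lte_fin ltrBrDr.
Qed.

Lemma J_lower_regularization : is_lower_regularization J J.
Proof. by split => //; exact: J_lower_semicontinuous. Qed.

Lemma J_lower_bound_open : lower_bound_open mu t J.
Proof.
move=> G oG; set L := net_liminf _.
have L0 : 0 <= L.
  apply: net_liminf_ge => r r0; apply: nearW => i.
  exact: le_trans (ltW r0) (poweR_ge0 _ _).
apply: sup_expN_le => // x Gx; apply: le_real_upper_bounds => r Lr.
have r0 : (0 < r)%R by rewrite -lte_fin (le_lt_trans L0).
(* The drop [m = - ln r] turns the error term [e^(-m)] into [r], which already exceeds the limit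
   inferior. *)
have [h Ah [hx hG]] :=
  algebra_peak algA A_vanishing (- ln r) A_sep A_nowhere oG Gx.
have := expR_le_net_liminf dirI t_gt0 t_cvg0 (A_continuous Ah)
  (exp_lam_cvg Ah) (open_borel oG) (fun y _ => hx y) hG.
rewrite opprK lnK ?posrE// => hL.
apply: (@le_trans _ _ (expR (lam h - h x))%:E).
  by rewrite -[X in expR X]opprB expeRN_le le_J.
by apply: (le_trans hL); rewrite ge_max lexx andbT ltW.
Qed.

(** Around each point of [S] some [h] nearly attaining [J] gives an open set on which Chebyshev's
    inequality yields the bound [r]; finitely many of them cover [S]. *)
Lemma J_upper_bound_compact : upper_bound_on mu t compact J.
Proof.
move=> S cS; apply: le_real_upper_bounds => r Sr.
have r0 : (0 < r)%R by rewrite -lte_fin (le_lt_trans (sup_expN_ge0 _ _) Sr).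
(* The induction runs through arbitrary subsets, which need not be Borel; hence the measurable
   superset [T]. *)
suff [T [mT ST Tr]] : exists T : set X,
    [/\ measurable (T : set (borel X)), S `<=` T &
        net_limsup (measure_power mu t T) <= r%:E].
  apply: le_trans Tr; apply: net_limsup_measure_power_subset => //.
  exact: compact_borel.
apply: (@compact_induction _ (fun S => exists T : set X,
    [/\ measurable (T : set (borel X)), S `<=` T &
        net_limsup (measure_power mu t T) <= r%:E]) _ cS).
- exists set0; split => //; apply: net_limsup_le => r' rr'; apply: nearW => i.
  rewrite /measure_power measure0 poweR0r ?gt_eqF// ltW// (lt_trans _ rr')//.
- move=> S1 S2 [T1 [mT1 ST1 Tr1]] [T2 [mT2 ST2 Tr2]]; exists (T1 `|` T2).
  split; first exact: measurableU.
    exact: setUSS.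
  exact: net_limsup_measure_powerU.
- by move=> S1 S2 S12 [T [mT ST Tr]]; exists T; split => //; exact: subset_trans ST.
move=> x Sx; have : expeR (- J x) < (expR (- - ln r))%:E.
  by rewrite opprK lnK ?posrE// (le_lt_trans _ Sr)// sup_expN_ge.
rewrite expeRN_lt => /lt_J[h Ah hr].
have ch := A_continuous Ah.
pose V := [set y | lam h - ln r < h y]%R.
have oV : open V by exact: continuous_gt_open.
exists V; first by apply: open_nbhs_nbhs; split; rewrite // /V/=; lra.
exists V; split => //; first exact: open_borel.
have := net_limsup_measure_power_le (a := lam h - ln r) dirI t_gt0 ch
  (exp_lam_cvg Ah) (open_borel oV) (fun y Vy => ltW Vy).
by rewrite opprB addrC subrK lnK ?posrE.
Qed.

Lemma J_vague_LDP : vague_LDP mu t J.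
Proof.
by split; [exact: J_ge0|exact: J_upper_bound_compact|exact: J_lower_bound_open].
Qed.

(** Chebyshev's inequality with [a = - e] off the compact set where [e <= |h|]. *)
Lemma net_limsup_compl_le h (e : R) : A h -> (0 < e)%R ->
  exists2 K : set X, compact K &
    (forall x, ~ K x -> (- e <= h x)%R) /\
    net_limsup (measure_power mu t (~` K)) <= (expR (lam h + e))%:E.
Proof.
move=> Ah e0; have [ch /(_ e e0) cK] := A_vanishing Ah.
have he x : ~ (e <= `|h x|)%R -> (- e <= h x)%R.
  by move=> /negP; rewrite -ltNge ltr_norml => /andP[/ltW].
exists [set x | e <= `|h x|]%R => //; split => //.
rewrite -[e in (_ + e)%R]opprK.
apply: net_limsup_measure_power_le => //; first exact: exp_lam_cvg.
by apply: measurableC; exact: compact_borel.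
Qed.

Let condition2 :=
  (ereal_sup [set (h x)%:E - Lambda mu t h | x in [set: X] & h in A] <=
   ereal_sup [set - Lambda mu t h | h in A]).

Let condition3 :=
  (ereal_sup [set J x | x in [set: X]] <=
   ereal_sup [set ereal_inf [set J x | x in ~` K] | K in [set K | compact K]]).

(** The hypothesis removes the term [h x]: whatever lies below [J] is also beaten by [- Lambda]
    alone, possibly at another function. *)
Lemma condition2_lt_J x (a : R) : condition2 -> a%:E < J x ->
  exists2 h, A h & (lam h < - a)%R.
Proof.
move=> c2 aJ; have : a%:E < ereal_sup [set - Lambda mu t h | h in A].
  apply: lt_le_trans c2; apply: (lt_le_trans aJ); apply: ereal_sup_le.
  by move=> _ [h Ah <-]; exists x => //; exists h.
move=> /ereal_sup_gt[_ [h Ah <-]]; rewrite LambdaE// -EFinN lte_fin => ah.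
by exists h => //; rewrite ltrNr.
Qed.

(** [F] is split by a compact [K] whose complement has mass at most [r] at the exponential scale;
    the compact part [K & F] falls under the bound already known. *)
Lemma condition2_upper_bound_closed :
  condition2 -> upper_bound_on mu t closed J.
Proof.
move=> c2 F cF; have [->|/set0P[x Fx]] := eqVneq F set0.
  by apply: J_upper_bound_compact; exact: compact0.
apply: le_real_upper_bounds => r Fr.
have r0 : (0 < r)%R by rewrite -lte_fin (le_lt_trans (sup_expN_ge0 _ _) Fr).
have : expeR (- J x) < (expR (- - ln r))%:E.
  by rewrite opprK lnK ?posrE// (le_lt_trans _ Fr)// sup_expN_ge.
(* The gap [ln r - lam h] serves as the [e] of [net_limsup_compl_le], whose bound is then
   [e^(ln r) = r]. *)
rewrite expeRN_lt => /(condition2_lt_J c2)[h Ah]; rewrite opprK -subr_gt0 => hr.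
have [K cK [_]] := net_limsup_compl_le Ah hr.
rewrite addrC subrK lnK ?posrE// => KCr.
have mK := compact_borel cK; have mF := closed_borel cF.
have cKF : compact (K `&` F) by exact: compact_closedI.
apply: (@le_trans _ _ (net_limsup (measure_power mu t ((K `&` F) `|` ~` K)))).
  apply: net_limsup_measure_power_subset => //.
    by apply: measurableU; [exact: measurableI|exact: measurableC].
  by move=> y Fy; have [Ky|nKy] := pselect (K y); [left|right].
apply: net_limsup_measure_powerU => //.
- exact: measurableI.
- exact: measurableC.
apply: (le_trans (J_upper_bound_compact cKF)).
by apply: le_trans (ltW Fr); apply: sup_expN_subset => y [].
Qed.

Lemma condition2_condition3 : condition2 -> condition3.
Proof.
move=> c2; apply: ge_ereal_sup => _ [x _ <-]; apply: le_real_lower_bounds => a.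
move=> /(condition2_lt_J c2)[h Ah ha].
(* With this [e], off [K] one has [h - lam h >= - e - lam h = a], hence [J >= a]. *)
have e0 : (0 < - a - lam h)%R by rewrite subr_gt0.
have [K cK [hK _]] := net_limsup_compl_le Ah e0.
apply: le_ereal_sup_tmp; exists (ereal_inf [set J x | x in ~` K]).
  by exists K.
apply: le_ereal_inf_tmp => _ [y /hK hy <-]; apply: le_trans (le_J y Ah).
by rewrite lee_fin; lra.
Qed.

(** [expR_le_net_liminf] at level [a = 0] with drop [m = r]. It is applied to negative multiples of
    functions that are at least 1 on a compact set. *)
Lemma lam_le h (S : set X) (r : R) : A h ->
  measurable (S : set (borel X)) -> (forall x, h x <= 0)%R ->
  (forall x, ~ S x -> h x <= - r)%R ->
  net_limsup (measure_power mu t S) <= (expR (- r))%:E -> (lam h <= - r)%R.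
Proof.
move=> Ah mS h0 hr Sr; rewrite -ler_expR -lee_fin -[lam h]subr0.
apply: le_trans (expR_le_net_liminf (m := r) dirI t_gt0 t_cvg0
  (A_continuous Ah) (exp_lam_cvg Ah) mS (fun x _ => h0 x) _) _.
  by move=> x /hr; rewrite sub0r.
rewrite ge_max lexx andbT; apply: le_trans Sr.
exact: net_liminf_le_limsup.
Qed.

Lemma exponentially_tight_iff : exponentially_tight mu t <->
  ereal_sup [set - Lambda mu t h | h in A] = +oo.
Proof.
split=> [tight|supy].
  apply/eqP; rewrite -leye_eq; apply: le_real_lower_bounds => r _.
  (* A nonnegative [r'] ensures that the test function [- r' * p] is nonpositive, and at most [- r']
     on [K]. *)
  pose r' := Num.max 0%R r.
  have r'0 : (0 <= r')%R by rewrite le_max lexx.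
  have [K cK Kr] := tight _ (expR_gt0 (- r')).
  have [p Ap [p0 p1]] := algebra_ge1_on_compact algA A_vanishing A_nowhere cK.
  have Ah : A (fun x => - r' * p x)%R by case: algA => _ _ + _; apply.
  apply: le_ereal_sup_tmp; exists (- (lam (fun x => - r' * p x)%R)%:E).
    by exists (fun x => - r' * p x)%R; rewrite ?LambdaE.
  rewrite -EFinN lee_fin; apply: (@le_trans _ _ r').
    by rewrite le_max lexx orbT.
  rewrite lerNr; apply: (lam_le (S := ~` K)) => //.
  - by apply: measurableC; exact: compact_borel.
  - by move=> x; rewrite mulNr oppr_le0 mulr_ge0.
  - by move=> x /contrapT /p1 px; rewrite mulNr lerN2 ler_peMr.
  - exact: ltW.
move=> e e0.
have : (- ln e)%:E < ereal_sup [set - Lambda mu t h | h in A].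
  by rewrite supy ltry.
move=> /ereal_sup_gt[_ [h Ah <-]]; rewrite LambdaE// -EFinN lte_fin => he.
(* Half of the gap is kept in reserve, as tightness asks for a strict inequality. *)
have d0 : (0 < (ln e - lam h) / 2)%R by lra.
have [K cK [_ Ke]] := net_limsup_compl_le Ah d0.
exists K => //; apply: (le_lt_trans Ke).
by rewrite lte_fin -[ltRHS]lnK ?posrE// ltr_expR; lra.
Qed.

(** * Identification of the rate function of a given large deviation principle *)

Section Uniqueness.
Variable l : X -> \bar R.
Hypothesis regX : regular_space X.
Hypothesis l_LDP : LDP mu t l.

(** On the open set where [h > r + lam h], the lower bound with [l] meets Chebyshev's upper bound
    [e^(-r)]. *)
Lemma J_le_LDP x : J x <= l x.
Proof.
have [_ _ l_lower] := l_LDP.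
apply: le_real_lower_bounds => r /lt_J[h Ah hr].
have ch := A_continuous Ah.
have oG : open [set y | r + lam h < h y]%R by exact: continuous_gt_open.
rewrite -expeRN_le; apply: (@le_trans _ _ (sup_expN l [set y | r + lam h < h y]%R)).
  by apply: sup_expN_ge; rewrite /= -ltrBrDr.
apply: (le_trans (l_lower _ oG)); apply: (le_trans (net_liminf_le_limsup _ dirI)).
have := net_limsup_measure_power_le (a := r + lam h) dirI t_gt0 ch
  (exp_lam_cvg Ah) (open_borel oG) (fun y Gy => ltW Gy).
by rewrite opprD addrCA subrr addr0.
Qed.

(** For maximality, the lower bound with [J] on the interior of a neighborhood is compared with the
    upper bound with [l] on its closure. *)
Lemma LDP_lower_regularization : is_lower_regularization l J.
Proof.
have [_ l_upper _] := l_LDP.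
split; [exact: J_lower_semicontinuous|exact: J_le_LDP|].
move=> g g_lsc gl x; apply: le_real_lower_bounds => r /g_lsc[V Vx rV].
(* Regularity provides a neighborhood whose closure stays inside [V], where [g > r] and therefore
   [l > r]. *)
have [B Bx BV] := regX Vx.
have mB : measurable (closure B : set (borel X)).
  by apply: closed_borel; exact: closed_closure.
have mBo : measurable (B^° : set (borel X)).
  by apply: open_borel; exact: open_interior.
rewrite -expeRN_le; apply: (@le_trans _ _ (sup_expN J B^°)).
  exact: sup_expN_ge.
apply: (le_trans (J_lower_bound_open (open_interior B))).
apply: (@le_trans _ _ (net_limsup (measure_power mu t (closure B)))).
  apply: (@le_trans _ _ (net_liminf (measure_power mu t (closure B)))).
    apply: net_liminf_measure_power_subset => //.
    by apply: (@subset_trans _ B); [exact: interior_subset|exact: subset_closure].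
  exact: net_liminf_le_limsup.
apply: (le_trans (l_upper _ (@closed_closure _ B))).
apply: sup_expN_le => [|y /BV/rV ry]; first by rewrite lee_fin expR_ge0.
by rewrite expeRN_le (le_trans (ltW ry)).
Qed.

Lemma LDP_condition3_condition2 : condition3 -> condition2.
Proof.
have [_ l_upper _] := l_LDP; move=> c3.
apply: ge_ereal_sup => _ [x _ [h Ah <-]]; rewrite LambdaE//.
apply: le_real_lower_bounds => r rh.
(* The zero function, with [Lambda] equal to 0, settles [r <= 0]; the function [k] below requires
   [r > 0]. *)
have [r0|r0] := leP r 0%R.
  apply: le_ereal_sup_tmp; exists (- Lambda mu t (fun=> 0%R)).
    by exists (fun=> 0%R).
  by rewrite LambdaE// lam0 oppe0 lee_fin.
have : r%:E < ereal_sup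
    [set ereal_inf [set J x | x in ~` K] | K in [set K | compact K]].
  apply: lt_le_trans c3; apply: (lt_le_trans rh).
  apply: le_ereal_sup_tmp; exists (J x); first by exists x.
  exact: le_J.
move=> /ereal_sup_gt[_ [K cK <-] rK].
have [p Ap [p0 p1]] := algebra_ge1_on_compact algA A_vanishing A_nowhere cK.
(* The complement of [K] need not be closed, so the upper bound is applied to the closed set where
   [k >= - r]. The factor 2 keeps this set disjoint from [K], on which [k <= - 2 r]. *)
pose k := fun x => (- (2 * r) * p x)%R.
have Ak : A k by case: algA => _ _ + _; apply.
have cF : closed [set y | - r <= k y]%R.
  by apply: continuous_ge_closed; exact: A_continuous.
apply: le_ereal_sup_tmp; exists (- Lambda mu t k); first by exists k.
rewrite LambdaE// -EFinN lee_fin lerNr.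
apply: (lam_le (S := [set y | - r <= k y]%R)) => //.
- exact: closed_borel.
- by move=> y; rewrite /k mulNr oppr_le0 mulr_ge0// mulr_ge0// ltW.
- by move=> y /negP; rewrite -ltNge => /ltW.
apply: (le_trans (l_upper _ cF)).
apply: sup_expN_le => [|y ky]; first by rewrite lee_fin expR_ge0.
rewrite expeRN_le; apply: le_trans (J_le_LDP y); apply: (le_trans (ltW rK)).
apply: ereal_inf_lbound; exists y => // /p1 py.
move: ky; rewrite /k/=; nra.
Qed.

End Uniqueness.

End VagueLargeDeviations.

(** * Large deviations, identification of the rate and exponential tightness together *)

Theorem theorem2 (R : realType) (X : ptopologicalType)
    (dI : Order.disp_t) (I : preorderType dI)
    (mu : I -> probability (borel X) R) (t : I -> R) (A : set (X -> R)) :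
  (exists x y : X, x <> y) ->
  (forall K : set X, compact K -> measurable (K : set (borel X))) ->
  directed I ->
  (forall i, 0 < t i) ->
  t @ tails I --> (0 : R) ->
  compact_neighborhoods X ->
  regular_space X ->
  function_algebra A ->
  (forall h, A h -> continuous_vanishing_at_infinity h) ->
  separates_points A ->
  vanishes_nowhere A ->
  (forall h, A h -> Lambda_exists mu t h) ->
  let J : X -> \bar R :=
    fun x => ereal_sup [set ((h x)%:E - Lambda mu t h)%E | h in A] in
  let condition2 : Prop :=
    (ereal_sup [set - Lambda mu t h | h in A] >=
     ereal_sup [set (h x)%:E - Lambda mu t h | x in [set: X] & h in A])%E in
  let condition3 : Prop :=
    (ereal_sup [set ereal_inf [set J x | x in ~` K] | K in [set K | compact K]]
     >= ereal_sup [set J x | x in [set: X]])%E in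
  [/\ vague_LDP_with_rate mu t J /\
        (condition2 -> LDP_with_rate mu t J /\ condition3),
      hausdorff_space X -> forall l : X -> \bar R, LDP mu t l ->
        is_lower_regularization l J /\ (condition3 -> condition2) &
      exponentially_tight mu t <->
        ereal_sup [set (- Lambda mu t h)%E | h in A] = +oo%E].
Proof.
move=> _ Kb dI' t0 tc _ regX algA Av As An AL J c2 c3.
have JJ : is_lower_regularization J J by exact: J_lower_regularization.
have vJ : vague_LDP mu t J by exact: J_vague_LDP.
split; last exact: exponentially_tight_iff.
  split; first by exists J.
  move=> C2; split; last exact: condition2_condition3 C2.
  (* [J] can be taken as [l], since it is its own lower regularization. *)
  exists J => //; case: vJ => J0 _ Jlow; split => //.
  exact: condition2_upper_bound_closed C2.
move=> _ l lLDP; split; first exact: LDP_lower_regularization lLDP.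
exact: LDP_condition3_condition2 lLDP.
Qed.
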